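(* Let $n\in\{2,3\}$, and let $d_i=\|a_i-x^o\|+r_i$, $i=1,2,\ldots$, be range measurements of an object at $x^o\in\mathbb R^n$ by sensors at $a_i\in\mathbb R^n$, satisfying assumptions (A1), (A2), (A3), (A6) of the context, with known noise variance $\sigma^2$. For each $m$ let $A\in\mathbb R^{m\times(n+1)}$ be the matrix with $i$-th row $[-2a_i^\top\ \ 1]$ and $b\in\mathbb R^m$ the vector with $i$-th entry $d_i^2-\|a_i\|^2-\sigma^2$. Let $\hat y^{\rm BEL}_m=(A^\top A)^{-1}A^\top b$ be the optimal solution of the least squares problem $\mathop{\rm minimize}_{y\in\mathbb R^{n+1}}\|Ay-b\|^2$, and let $\hat x^{\rm BEL}_m=[\hat y^{\rm BEL}_m]_{1:n}$ consist of its first $n$ coordinates (the Bias-Eli-Lin estimator). Then the Bias-Eli-Lin estimator is $\sqrt m$-consistent, i.e. $\hat x^{\rm BEL}_m-x^o=O_p(1/\sqrt m)$.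
   Context: $X_m=O_p(\alpha_m)$ means that $X_m/\alpha_m$ is stochastically bounded: for every $\epsilon>0$ there exist finite $M,N$ such that $P(|X_m/\alpha_m|>N)<\epsilon$ for all $m>M$ (with the norm in place of the absolute value for vectors). The formula for $\hat y^{\rm BEL}_m$ is used for those $m$ for which $A^\top A$ is invertible (all sufficiently large $m$ under the assumptions). The sample distribution function of a sequence $(z_1,z_2,\ldots)$ in $\mathbb R^n$ is $F_m(z)=\#\{i\le m: z_i\preceq z\}/m$, where $\preceq$ is the coordinatewise inequality. Assumptions. (A1) The $r_i$ are i.i.d. Gaussian with mean $0$ and finite variance $\sigma^2$. (A2) $x^o$ is an interior point of a compact set $\mathcal X\subset\mathbb R^n$; all the (deterministic) sensor positions $a_i$ lie in a bounded set $\mathcal A\subset\mathbb R^n$, and $a_i\notin\mathcal X$ for each $i$. (A3) The sample distribution function $F_m$ of $(a_1,a_2,\ldots)$ converges to a distribution function $F_\mu$, i.e. $F_m(a)\to F_\mu(a)$ at every continuity point $a\in\mathbb R^n$ of $F_\mu$; $\mu$ denotes the probability measure generated by $F_\mu$. (A6) There is no (affine) line $\mathcal S$ (if $n=2$), respectively plane $\mathcal S$ (if $n=3$), such that $\mu(\mathcal S)=1$. *)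

(* Defs.v *)
From HB Require Import structures.
From mathcomp Require Import all_boot all_order all_algebra finmap.
From mathcomp Require Import all_classical all_reals all_analysis.

Set Implicit Arguments.
Unset Strict Implicit.
Unset Printing Implicit Defensive.

Import Order.TTheory GRing.Theory Num.Theory.
Import numFieldNormedType.Exports.

Local Open Scope classical_set_scope.
Local Open Scope ring_scope.

(* R^n is 'cV[R]_n. The library norm `|x| on matrices is the sup norm (same
   topology and bounded sets), so the Euclidean norm is introduced here. *)
Definition enorm (R : realType) (n : nat) (x : 'cV[R]_n) : R :=
  Num.sqrt (\sum_(k < n) x k 0 ^+ 2).

Definition cle (R : realType) (n : nat) (x z : 'cV[R]_n) : bool :=
  [forall k, x k 0 <= z k 0].

Definition borelType (R : realType) (n : nat) :=
  g_sigma_algebraType (@open 'cV[R]_n).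

Definition sample_df (R : realType) (n : nat) (a : nat -> 'cV[R]_n) (m : nat)
    (z : 'cV[R]_n) : R :=
  #|[pred i : 'I_m | cle (a i) z]|%:R / m%:R.

Definition distribution_function (R : realType) (n : nat)
    (mu : probability (borelType R n) R) (z : 'cV[R]_n) : R :=
  fine (mu [set x | cle x z]).

(* S is an affine subspace of dimension k: a line for k = 1, a plane for
   k = 2. *)
Definition affine_flat (R : realType) (n k : nat) (S : set 'cV[R]_n) : Prop :=
  exists (p : 'cV[R]_n) (W : {vspace 'cV[R]_n}),
    \dim W = k /\ S = [set p + w | w in [set w | w \in W]].

(* Law of N(mean, s^2). The library's [normal_prob mean 0] is the uniform law
   on [0, 1], hence the separate case for zero variance. *)
Definition gaussian_law (R : realType) (mean s : R) (B : set R) : \bar R :=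
  if s == 0 then dirac mean B else normal_prob mean s B.

Definition mutually_independent (d : measure_display) (T : measurableType d)
    (R : realType) (P : probability T R) (X : nat -> {RV P >-> R}) : Prop :=
  forall (J : {fset nat}) (B : nat -> set R),
    (forall j, measurable (B j)) ->
    P (\bigcap_(j in [set` J]) (X j @^-1` B j)) =
      (\prod_(j <- J) P (X j @^-1` B j))%E.

(* Identical distribution is part of this: all laws equal N(0, s^2). *)
Definition iid_centered_gaussian (d : measure_display) (T : measurableType d)
    (R : realType) (P : probability T R) (s : R)
    (X : nat -> {RV P >-> R}) : Prop :=
  mutually_independent X /\
  forall i (B : set R), measurable B -> P (X i @^-1` B) = gaussian_law 0 s B.

Definition bigO_p (d : measure_display) (T : measurableType d)
    (R : realType) (P : probability T R) (n : nat)
    (X : nat -> T -> 'cV[R]_n) (alpha : nat -> R) : Prop :=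
  forall eps : R, 0 < eps ->
    exists (M : nat) (N : R), forall m : nat, (M < m)%N ->
      (P [set w | N < enorm ((alpha m)^-1 *: X m w)]%R < eps%:E)%E.

Definition range_meas (d : measure_display) (T : measurableType d)
    (R : realType) (P : probability T R) (n : nat) (a : nat -> 'cV[R]_n)
    (xo : 'cV[R]_n) (r : nat -> {RV P >-> R}) (i : nat) (w : T) : R :=
  enorm (a i - xo) + r i w.

(* Sensors are indexed from 0: the first m of them are a 0, ..., a (m - 1). *)
Definition BEL_A (R : realType) (n : nat) (a : nat -> 'cV[R]_n) (m : nat) :
    'M[R]_(m, n + 1) :=
  \matrix_(i < m) row_mx (- 2%:R *: (a i)^T) (const_mx 1).

Definition BEL_b (R : realType) (n : nat) (a : nat -> 'cV[R]_n) (s : R)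
    (dm : nat -> R) (m : nat) : 'cV[R]_m :=
  \col_(i < m) (dm i ^+ 2 - enorm (a i) ^+ 2 - s ^+ 2).

(* Only the values at those m for which A^T A is invertible are prescribed;
   yhat m is left arbitrary for the other m. *)
Definition is_BEL (d : measure_display) (T : measurableType d)
    (R : realType) (P : probability T R) (n : nat) (a : nat -> 'cV[R]_n)
    (s : R) (xo : 'cV[R]_n) (r : nat -> {RV P >-> R})
    (yhat : nat -> T -> 'cV[R]_(n + 1)) : Prop :=
  forall (m : nat) (w : T),
    let A := BEL_A a m in
    let b := BEL_b a s (fun i => range_meas a xo r i w) m in
    A^T *m A \in unitmx -> yhat m w = invmx (A^T *m A) *m A^T *m b.

(* Main.v *)
(* Writing [y0 = (xo, |xo|^2)], the data satisfy [b = A y0 + eta] where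
   [eta_i = 2 |a_i - xo| r_i + r_i^2 - sigma^2] are centred, uncorrelated and
   have bounded variance, so that [yhat - y0 = (A^T A)^-1 A^T eta] and the
   coordinates of [yhat - y0] have second moments at most [V] times the
   diagonal entries of [(A^T A)^-1]. These entries are O(1/m) as soon as
   [v^T A^T A v >= c m |v|^2] for all [v] and all large [m], and Markov's
   inequality concludes.
   For the lower bound, [v^T A^T A v] is the sum of the squares of an affine
   form [l_v] at the sensors. Since [mu] is not carried by a hyperplane, the
   open set [|l_v| > e] has positive [mu]-measure for some [e > 0]. If the
   empirical frequencies of an open set were not bounded away from 0, every
   box inside it with corners at continuity points would be [mu]-null, and
   countably many such boxes cover it; hence a positive proportion of the
   sensors satisfies [|l_v| > e], and compactness of the unit sphere makes this
   uniform in [v]. *)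
Require Import Defs.
From HB Require Import structures.
From mathcomp Require Import all_boot all_order all_algebra finmap.
From mathcomp Require Import all_classical all_reals all_analysis.
From mathcomp Require Import measurable_realfun ring lra.

Set Implicit Arguments.
Unset Strict Implicit.
Unset Printing Implicit Defensive.

Import Order.TTheory GRing.Theory Num.Theory.
Import numFieldNormedType.Exports.

Local Open Scope classical_set_scope.
Local Open Scope ring_scope.

(** * Gaussian moments *)

Section density.
Import HBNNSimple.

(** Simple functions increasing to [f] reduce both sides, by monotone convergence, to a simple
    function. There the identity is the hypothesis on [nu] applied to each level set. *)
Lemma ge0_integral_density d (T : measurableType d) (R : realType)
    (mu nu : {measure set T -> \bar R}) (g : T -> R) (f : T -> R) :
  measurable_fun setT g -> (forall x, 0 <= g x) ->
  (forall A, measurable A -> nu A = \int[mu]_(x in A) (g x)%:E)%E ->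
  measurable_fun setT f -> (forall x, 0 <= f x) ->
  (\int[nu]_x (f x)%:E = \int[mu]_x (f x * g x)%:E)%E.
Proof.
move=> mg g0 nuE mf f0.
have /measurable_EFinP mEf := mf.
pose f_ := nnsfun_approx measurableT mEf.
have f_cvg x : (f_ n x)%:E @[n --> \oo] --> (f x)%:E.
  by apply: (cvg_nnsfun_approx measurableT mEf) => //= y _; rewrite lee_fin.
have nd_f x m n : (m <= n)%N -> (f_ m x <= f_ n x)%R.
  by move=> mn; exact/lefP/nd_nnsfun_approx.
transitivity (lim (\int[nu]_x (f_ n x)%:E @[n --> \oo])%E).
  rewrite -monotone_convergence//=.
  - by apply: eq_integral => x _; apply/esym/cvg_lim => //; exact: f_cvg.
  - by move=> n; exact/measurable_EFinP.
  - by move=> n x _; rewrite lee_fin.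
  - by move=> x _ m n mn; rewrite lee_fin nd_f.
transitivity (lim (\int[mu]_x (f_ n x * g x)%:E @[n --> \oo])%E); last first.
  rewrite -monotone_convergence//=.
  - apply: eq_integral => x _; apply/cvg_lim => //.
    by rewrite EFinM; under eq_fun do rewrite EFinM; apply: cvgeZr.
  - by move=> n; apply/measurable_EFinP; apply: measurable_funM.
  - by move=> n x _; rewrite lee_fin mulr_ge0.
  - by move=> x _ m n mn; rewrite lee_fin ler_wpM2r// nd_f.
apply: congr_lim; apply/funext => n; move: (f_ n) => h.
under [LHS]eq_integral do rewrite fimfunE -fsumEFin//.
rewrite [LHS]ge0_integral_fsum//; last 2 first.
  - by move=> r; exact/measurable_EFinP/measurableT_comp.
  - by move=> k x _; rewrite EFinM nnfun_muleindic_ge0.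
under [RHS]eq_integral => x _.
  rewrite fimfunE EFinM -fsumEFin// ge0_mule_fsuml; last first.
    by move=> r; rewrite EFinM nnfun_muleindic_ge0.
  over.
rewrite [RHS]ge0_integral_fsum//; last 2 first.
  - move=> r; apply: emeasurable_funM; last exact/measurable_EFinP.
    by apply/measurable_EFinP/measurable_funM => //; exact: measurable_indic.
  - move=> r x _; apply: mule_ge0; last by rewrite lee_fin.
    by rewrite EFinM nnfun_muleindic_ge0.
apply: eq_fsbigr => r _.
rewrite integralZl_indic_nnsfun//.
rewrite (integral_indic nu measurableT)// setIT.
(* A nonnegative simple function has no negative level. With [0 <= r] the constant can leave the
   integral. *)
have [r0|r0] := ltP r 0.
  rewrite preimage_nnfun0// measure0 mule0 integral0_eq// => x _.
  by rewrite indic0 mulr0 mul0e.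
under [RHS]eq_integral do rewrite EFinM -muleA.
rewrite ge0_integralZl//; last 2 first.
- by apply/emeasurable_funM/measurable_EFinP => //; exact/measurable_EFinP/measurable_indic.
- by move=> x _; rewrite mule_ge0 ?lee_fin.
congr (_ * _)%E; rewrite nuE// [LHS]integral_mkcond.
by apply: eq_integral => x _; rewrite patchE indicE; case: ifP => _; rewrite ?mul1e ?mul0e.
Qed.

End density.

Section normal_moments.
Context {R : realType}.
Implicit Types s t u x : R.

Lemma ge0_integral_normal_prob s (f : R -> R) :
  measurable_fun [set: R] f -> (forall x, 0 <= f x) ->
  (\int[normal_prob 0 s]_x (f x)%:E =
   \int[lebesgue_measure]_x (f x * normal_pdf 0 s x)%:E)%E.
Proof.
move=> mf f0; apply: ge0_integral_density => //.
- exact: measurable_normal_pdf.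
- by move=> x; exact: normal_pdf_ge0.
Qed.

(** Completing the square: [expR (t * x)] times the centred density is a constant times the density
    with mean [t * s ^+ 2]. *)
Lemma normal_prob_mgf s t : s != 0 ->
  (\int[normal_prob 0 s]_x (expR (t * x))%:E = (expR (t ^+ 2 * s ^+ 2 / 2))%:E)%E.
Proof.
move=> s0; rewrite ge0_integral_normal_prob; last 2 first.
- by apply: measurableT_comp => //; exact: measurable_funM.
- by move=> x; exact: expR_ge0.
transitivity (\int[lebesgue_measure]_x
    ((expR (t ^+ 2 * s ^+ 2 / 2))%:E * (normal_pdf (t * s ^+ 2) s x)%:E))%E.
  apply: eq_integral => x _; rewrite -EFinM; congr (_%:E).
  rewrite !normal_pdfE// /normal_fun mulrCA [RHS]mulrCA; congr (_ * _).
  by rewrite -!expRD; congr expR; field.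
rewrite ge0_integralZl ?integral_normal_pdf ?mule1//.
- by apply/measurable_EFinP; exact: measurable_normal_pdf.
- by move=> x _; rewrite lee_fin normal_pdf_ge0.
Qed.

(** The exponent is the one that turns the density of standard deviation [s] into [u] times that of
    standard deviation [u * s]. Varying [u] near 1 gives access to the second moment, as varying [t]
    near 0 in [normal_prob_mgf] does to the first. *)
Lemma normal_prob_integral_expR_sqr s u : 0 < s -> 0 < u ->
  (\int[normal_prob 0 s]_x
     (expR (x ^+ 2 / (s ^+ 2 *+ 2) * (1 - (u ^+ 2)^-1)))%:E = u%:E)%E.
Proof.
move=> s0 u0; rewrite ge0_integral_normal_prob; last 2 first.
- by apply: measurableT_comp => //; apply: measurable_funM => //; apply: measurable_funM.
- by move=> x; exact: expR_ge0.
have us0 : u * s != 0 by rewrite gt_eqF// mulr_gt0.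
transitivity (\int[lebesgue_measure]_x
    (u%:E * (normal_pdf 0 (u * s) x)%:E))%E.
  apply: eq_integral => x _; rewrite -EFinM; congr (_%:E).
  rewrite !normal_pdfE ?(gt_eqF s0)// /normal_fun mulrCA [RHS]mulrA; congr (_ * _); last first.
    by rewrite -expRD; congr expR; field; rewrite !gt_eqF.
  rewrite /normal_peak exprMn -!mulrnAr -[in RHS]mulrA.
  rewrite [in RHS]sqrtrM ?sqr_ge0// sqrtr_sqr gtr0_norm//.
  by rewrite invfM mulrA divff ?mul1r// gt_eqF.
rewrite ge0_integralZl ?integral_normal_pdf ?mule1//.
- by apply/measurable_EFinP; exact: measurable_normal_pdf.
- by move=> x _; rewrite lee_fin normal_pdf_ge0.
- by rewrite lee_fin ltW.
Qed.

(* [expR (x ^+ 2 / (4 * s ^+ 2))], the case [u ^+ 2 = 2] above, dominates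
   [x ^+ 4]. *)
Lemma normal_prob_integrable_expr4 s : 0 < s ->
  (normal_prob 0 s).-integrable [set: R] (fun x => (x ^+ 4)%:E).
Proof.
move=> s0; have s0W := ltW s0; have s20 : 0 < s ^+ 2 by rewrite exprn_gt0.
pose u : R := Num.sqrt 2.
have u0 : 0 < u by rewrite sqrtr_gt0.
have uE : u ^+ 2 = 2 by rewrite sqr_sqrtr.
apply: (@le_integrable _ (measurableTypeR R) R (normal_prob 0 s) setT measurableT _
  (fun x : measurableTypeR R => (64 * s ^+ 4 *
     expR (x ^+ 2 / (s ^+ 2 *+ 2) * (1 - (u ^+ 2)^-1)))%:E)).
- by apply/measurable_EFinP; exact: exprn_measurable.
- move=> x _ /=; rewrite lee_fin ger0_norm ?exprn_even_ge0//.
  rewrite ger0_norm ?mulr_ge0 ?expR_ge0 ?exprn_even_ge0//.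
  set y := _ * (1 - _).
  have yE : x ^+ 2 = 4 * s ^+ 2 * y.
    by rewrite /y uE; field; rewrite gt_eqF.
  have y0 : 0 <= y.
    by rewrite -(pmulr_rge0 _ (_ : 0 < 4 * s ^+ 2)) ?mulr_gt0// -yE sqr_ge0.
  (* This is [1 + y / 2 <= expR (y / 2)] squared. Since [x ^+ 4 = 16 * s ^+ 4 * y ^+ 2], the
     dominating constant is [64 * s ^+ 4]. *)
  have ey : y ^+ 2 / 4 <= expR y.
    rewrite (_ : y = y / 2 + y / 2) ?expRD; last by field.
    have := expR_ge1Dx (y / 2); nra.
  have x4 : x ^+ 4 = 64 * s ^+ 4 * (y ^+ 2 / 4) by rewrite (exprM x 2 2) yE; field.
  by rewrite x4 ler_wpM2l// mulr_ge0// exprn_even_ge0.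
- apply/integrableP; split.
    apply/measurable_EFinP; apply: measurable_funM => //.
    by apply: measurableT_comp => //; apply: measurable_funM => //; apply: measurable_funM.
  under eq_integral do rewrite /= ger0_norm ?mulr_ge0 ?expR_ge0 ?exprn_even_ge0// EFinM.
  rewrite ge0_integralZl ?normal_prob_integral_expR_sqr// -?EFinM ?ltry//.
  - apply/measurable_EFinP; apply: measurableT_comp => //.
    by apply: measurable_funM => //; apply: measurable_funM.
  - by rewrite lee_fin mulr_ge0// exprn_ge0.
Qed.

End normal_moments.

Section normal_mean_variance.
Context {R : realType}.
Implicit Types s u : R.

Lemma normal_prob_integrable_expr s n : 0 < s -> (n <= 4)%N ->
  (normal_prob 0 s).-integrable [set: R] (fun x => (x ^+ n)%:E).
Proof.
move=> s0 n4.
apply: (@le_integrable _ (measurableTypeR R) R (normal_prob 0 s) setT measurableT _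
  (fun x : measurableTypeR R => (1%:E + (x ^+ 4)%:E)%E)).
- by apply/measurable_EFinP; exact: exprn_measurable.
- move=> x _ /=; rewrite lee_fin normrX.
  rewrite [leRHS]ger0_norm ?addr_ge0 ?exprn_even_ge0//.
  have -> : x ^+ 4 = `|x| ^+ 4 by rewrite -normrX ger0_norm ?exprn_even_ge0.
  have [x1|/ltW x1] := leP `|x| 1.
    by rewrite ler_wpDr ?exprn_ge0// exprn_ile1.
  by rewrite ler_wpDl// ler_weXn2l.
- apply: integrableD => //; last exact: normal_prob_integrable_expr4.
  exact: finite_measure_integrable_cst.
Qed.

(** Integrating a tangent-line inequality bounds a moment by a known exponential integral. Moments
    then follow from varying the parameter [t], without differentiation under the integral sign. *)
Lemma integral_tangent_le d (T : measurableType d) (P : probability T R)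
    (f g : T -> R) (t c : R) :
  P.-integrable setT (EFin \o f) -> measurable_fun setT g ->
  (forall x, 0 <= g x) -> (forall x, 1 + t * f x <= g x) ->
  (\int[P]_x (g x)%:E = c%:E)%E -> 1 + t * fine (\int[P]_x (f x)%:E) <= c.
Proof.
move=> intf mg g0 fg gc.
have intg : P.-integrable setT (EFin \o g).
  apply/integrableP; split; first exact/measurable_EFinP.
  by under eq_integral do rewrite /= ger0_norm//; rewrite gc ltry.
rewrite -lee_fin -gc EFinD EFinM fineK; last exact: integrable_fin_num.
have -> : (1%:E + t%:E * \int[P]_x (f x)%:E =
    \int[P]_x (1%:E + t%:E * (f x)%:E))%E.
  rewrite integralD//=; last 2 first.
  - exact: finite_measure_integrable_cst.
  - exact: integrableZl.
  rewrite integralZl// integral_cst// mul1e; congr (_ + _)%E.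
  exact/esym/probability_setT.
apply: le_integral => //.
- apply: integrableD => //; first exact: finite_measure_integrable_cst.
  exact: integrableZl.
- by move=> x _; rewrite -EFinM -EFinD lee_fin.
Qed.

(* The bound [1 + t * m <= expR (t ^+ 2 * s ^+ 2 / 2)] is an equality at [t = 0],
   so the derivatives at 0 agree: [m = 0]. *)
Lemma normal_prob_mean s : 0 < s -> (\int[normal_prob 0 s]_x x%:E = 0)%E.
Proof.
move=> s0; have ix := normal_prob_integrable_expr s0 (isT : (1 <= 4)%N).
have fx := integrable_fin_num measurableT ix.
set m := fine (\int[normal_prob 0 s]_x x%:E).
have mE t : 1 + t * m <= expR (t ^+ 2 * s ^+ 2 / 2).
  apply: (integral_tangent_le ix _ _ _ (normal_prob_mgf t (lt0r_neq0 s0))).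
  - by apply: measurableT_comp => //; exact: measurable_funM.
  - by move=> x; exact: expR_ge0.
  - by move=> x; exact: expR_ge1Dx.
suff m0 : m = 0 by rewrite -[LHS]fineK// -/m m0.
apply/eqP; apply: contraT => mneq0.
have m2 : 0 < m ^+ 2 by rewrite exprn_even_gt0.
pose c := s ^+ 2 / 2.
have c0 : 0 < c by rewrite divr_gt0 ?exprn_gt0.
(* The bound is tested at [t = e * m], where the linear term [e * m ^+ 2] has order [e] and the
   exponent only order [e ^+ 2]. This [e] satisfies [e <= 1] and [e * c * (1 + m ^+ 2) < 1 / 2],
   which contradicts the last inequality obtained. *)
pose e := (1 + 2 * c * (1 + m ^+ 2))^-1.
have D0 : 0 < 1 + 2 * c * (1 + m ^+ 2) by nra.
have e0 : 0 < e by rewrite invr_gt0.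
have eE : e + 2 * (e * c) * (1 + m ^+ 2) = 1.
  by rewrite /e; field; rewrite gt_eqF.
have ec0 : 0 < e * c by rewrite mulr_gt0.
have := mE (e * m).
rewrite (_ : (e * m) ^+ 2 * s ^+ 2 / 2 = e * (e * c) * m ^+ 2); last by rewrite /c; field.
set y := e * (e * c) * m ^+ 2 => mey.
(* From [1 - y <= expR (- y)]; it replaces the exponential by a polynomial bound. *)
have ey : (1 - y) * expR y <= 1.
  by rewrite -ler_pdivlMr ?expR_gt0// div1r -expRN expR_ge1Dx.
have e1 : e <= 1 by nra.
have ecm : e * c * m ^+ 2 <= 2^-1 by nra.
have y1 : y <= 2^-1 by rewrite /y -mulrA; nra.
have : (1 - y) * (1 + e * m * m) <= 1.
  by apply: le_trans ey; rewrite ler_wpM2l//; lra.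
have yem : y = (e * c) * (e * m ^+ 2) by rewrite /y; ring.
have ek : e * m * m = e * m ^+ 2 by ring.
rewrite ek yem; have : 0 < e * m ^+ 2 by rewrite mulr_gt0.
have : e * m ^+ 2 <= m ^+ 2 by rewrite ler_piMl// ltW.
move: ec0 eE; set A := e * c; set z := e * m ^+ 2 => A0 eE zm z0.
have -> : (1 - A * z) * (1 + z) = 1 + z * (1 - A * (1 + z)) by ring.
rewrite gerDl pmulr_rle0// => Az; exfalso.
have : A * (1 + z) <= A * (1 + m ^+ 2) by rewrite ler_pM2l// lerD2l.
lra.
Qed.

(* Likewise the bound [qE] below is an equality at [u = 1]; comparing the
   derivatives there gives [q = 1]. *)
Lemma normal_prob_expr2 s : 0 < s ->
  (\int[normal_prob 0 s]_x (x ^+ 2)%:E = (s ^+ 2)%:E)%E.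
Proof.
move=> s0; have ix := normal_prob_integrable_expr s0 (isT : (2 <= 4)%N).
have fx := integrable_fin_num measurableT ix.
set m := fine (\int[normal_prob 0 s]_x (x ^+ 2)%:E).
have s20 : 0 < s ^+ 2 by rewrite exprn_gt0.
pose q := m / s ^+ 2.
have q0 : 0 <= q.
  by rewrite divr_ge0 ?(ltW s20)// fine_ge0// integral_ge0// => x _; rewrite lee_fin sqr_ge0.
have qE u : 0 < u -> 2 + (1 - (u ^+ 2)^-1) * q <= 2 * u.
  move=> u0.
  have -> : 2 + (1 - (u ^+ 2)^-1) * q = 2 * (1 + (1 - (u ^+ 2)^-1) / (s ^+ 2 *+ 2) * m).
    by rewrite /q; field; rewrite !gt_eqF.
  rewrite ler_pM2l//.
  apply: (integral_tangent_le ix _ _ _ (normal_prob_integral_expR_sqr s0 u0)).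
  - by apply: measurableT_comp => //; apply: measurable_funM => //; apply: measurable_funM.
  - by move=> x; exact: expR_ge0.
  - move=> x; rewrite [in leRHS]mulrAC [in leRHS](mulrC (x ^+ 2)) [in leRHS]mulrAC.
    exact: expR_ge1Dx.
suff q1 : q = 1.
  by rewrite -[LHS]fineK// -/m -[m](divfK (lt0r_neq0 s20)) -/q q1 mul1r.
(* After multiplication by [u ^+ 2] both sides contain the factor [1 - u]. Cancelling it at
   [u = 1 + h] bounds [q] from above, and at [u = 1 - h] from below. *)
have {}qE u : 0 < u -> 2 * (u ^+ 2 * (1 - u)) <= (1 - u) * (1 + u) * q.
  move=> u0; have u20 : 0 < u ^+ 2 by rewrite exprn_gt0.
  have := qE u u0; rewrite -(ler_pM2l u20).
  have -> : u ^+ 2 * (2 + (1 - (u ^+ 2)^-1) * q) = u ^+ 2 * 2 - (1 - u) * (1 + u) * q.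
    by field; rewrite gt_eqF.
  lra.
apply/eqP; rewrite eq_le; apply/andP; split.
  apply/ler_addgt0Pr => e e0.
  pose h := Num.min 1 (e / 3).
  have h0 : 0 < h by rewrite lt_min ltr01 divr_gt0.
  have [h1 he] : h <= 1 /\ h <= e / 3 by rewrite !ge_min !lexx orbT.
  have : h * ((2 + h) * q) <= h * (2 * (1 + h) ^+ 2).
    by have := qE (1 + h); rewrite addr_gt0// => /(_ isT); lra.
  rewrite ler_pM2l// => hq; nra.
apply/ler_addgt0Pr => e e0.
pose h := Num.min 2^-1 (e / 2).
have h0 : 0 < h by rewrite lt_min invr_gt0 ltr0n divr_gt0.
have [h1 he] : h <= 2^-1 /\ h <= e / 2 by rewrite !ge_min !lexx orbT.
have : h * (2 * (1 - h) ^+ 2) <= h * ((2 - h) * q).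
  have u0 : 0 < 1 - h by lra.
  by have := qE _ u0; lra.
rewrite ler_pM2l// => hq; nra.
Qed.

End normal_mean_variance.

(** * Independence and second moments *)

Section law_transfer.
Context {d d'} {T : measurableType d} {T' : measurableType d'} {R : realType}.
Variables (P : probability T R) (X : {RV P >-> T'}).
Variable nu : {measure set T' -> \bar R}.
Hypothesis lawX : forall B, measurable B -> P (X @^-1` B) = nu B.

Lemma law_integrable (f : T' -> \bar R) :
  nu.-integrable setT f -> P.-integrable setT (f \o X).
Proof.
move=> /integrableP[mf foo]; apply/integrableP; split.
  exact: measurableT_comp.
rewrite -(ge0_integral_distribution X (f := abse \o f)); last 2 first.
- exact: measurableT_comp.
- by move=> y; exact: abse_ge0.
by rewrite (eq_measure_integral nu)// => A mA _; exact: lawX.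
Qed.

Lemma law_integral (f : T' -> \bar R) :
  nu.-integrable setT f -> (\int[P]_w f (X w) = \int[nu]_x f x)%E.
Proof.
move=> intf; rewrite -(integral_distribution (X := X)); last 2 first.
- exact: measurable_int intf.
- exact: law_integrable.
by apply: eq_measure_integral => A mA _; exact: lawX.
Qed.

End law_transfer.

Section independent_pair.
Context {d d1 d2} {T : measurableType d} {T1 : measurableType d1}
  {T2 : measurableType d2} {R : realType}.
Variables (P : probability T R) (X : {RV P >-> T1}) (Y : {RV P >-> T2}).
Hypothesis indep : forall A B, measurable A -> measurable B ->
  P (X @^-1` A `&` Y @^-1` B) = (P (X @^-1` A) * P (Y @^-1` B))%E.

(** Independence makes the joint law agree with the product of the marginals on rectangles, hence
    everywhere. Tonelli gives integrability of the product and Fubini splits its integral. *)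
Lemma independent_integralM (f : T1 -> R) (g : T2 -> R) :
  measurable_fun setT f -> measurable_fun setT g ->
  P.-integrable setT (fun w => (f (X w))%:E) ->
  P.-integrable setT (fun w => (g (Y w))%:E) ->
  P.-integrable setT (fun w => (f (X w) * g (Y w))%:E) /\
  (\int[P]_w (f (X w) * g (Y w))%:E =
   \int[P]_w (f (X w))%:E * \int[P]_w (g (Y w))%:E)%E.
Proof.
move=> mf mg intf intg.
have mXY : measurable_fun setT (fun w => (X w, Y w)).
  exact: measurable_fun_pair.
pose XY : {RV P >-> (T1 * T2)%type} := HB.pack (fun w => (X w, Y w))
  (isMeasurableFun.Build _ _ _ _ _ mXY).
pose m1 := distribution P X; pose m2 := distribution P Y.
have lawXY C : measurable C -> P (XY @^-1` C) = (m1 \x m2)%E C.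
  move=> mC; apply/esym.
  apply: (@product_measure_unique _ _ _ _ _ m1 m2 (distribution P XY) _ _ mC).
  exact: indep.
pose h (z : T1 * T2) := ((f z.1 * g z.2)%:E).
have mh : measurable_fun setT h.
  apply/measurable_EFinP; apply: measurable_funM.
    by apply: measurableT_comp.
  by apply: measurableT_comp.
have fin_f : m1.-integrable setT (EFin \o f).
  by apply: integrable_pushforward => //; exact/measurable_EFinP.
have fin_g : m2.-integrable setT (EFin \o g).
  by apply: integrable_pushforward => //; exact/measurable_EFinP.
have inth : (m1 \x m2)%E.-integrable setT h.
  apply/integrable12ltyP => //; rewrite /h /=.
  under eq_integral => x _.
    under eq_integral do rewrite normrM EFinM.
    rewrite ge0_integralZl//; last first.
      by apply/measurable_EFinP; apply: measurableT_comp.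
    over.
  rewrite ge0_integralZr//; last 2 first.
  - by apply/measurable_EFinP; apply: measurableT_comp.
  - exact: integral_ge0.
  move/integrableP : fin_f => [_ f1]; move/integrableP : fin_g => [_ g1].
  by rewrite lte_mul_pinfty// ?ge0_fin_numE ?integral_ge0.
split; first exact: (law_integrable lawXY inth).
rewrite (law_integral lawXY inth) -integral12_prod_meas1// /fubini_F.
under eq_integral => x _.
  rewrite /h; under eq_integral do rewrite /= EFinM.
  rewrite integralZl//.
  over.
rewrite /= -(fineK (integrable_fin_num measurableT fin_g)) integralZr//.
rewrite fineK ?(integrable_fin_num measurableT fin_g)//.
congr (_ * _)%E; rewrite integral_distribution//; exact/measurable_EFinP.
Qed.

End independent_pair.

Lemma gaussian_law_moments d (T : measurableType d) (R : realType)
    (P : probability T R) (X : {RV P >-> R}) (s : R) :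
  0 <= s ->
  (forall B, measurable B -> P (X @^-1` B) = gaussian_law 0 s B) ->
  [/\ forall n, (n <= 4)%N -> P.-integrable setT (fun w => (X w ^+ n)%:E),
      (\int[P]_w (X w)%:E = 0)%E &
      (\int[P]_w (X w ^+ 2)%:E = (s ^+ 2)%:E)%E].
Proof.
rewrite le_eqVlt => /predU1P[<-|s0] lawX.
  have {}lawX B : measurable B -> P (X @^-1` B) = dirac (0 : R) B.
    by move=> mB; rewrite lawX// /gaussian_law eqxx.
  have intX n : (\d_(0 : R)).-integrable setT (fun x => (x ^+ n)%:E : \bar R).
    apply/integrableP; split; first by apply/measurable_EFinP; exact: exprn_measurable.
    rewrite integral_dirac//; last first.
      by apply: measurableT_comp => //; apply/measurable_EFinP; exact: exprn_measurable.
    by rewrite diracT mul1e ltry.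
  split.
  - move=> n _; exact (law_integrable lawX (intX n)).
  - rewrite (law_integral lawX (intX 1%N)) integral_dirac//; first by rewrite mule0.
    exact: measurable_int (intX 1%N).
  - rewrite (law_integral lawX (intX 2)) integral_dirac//; first by rewrite diracT mul1e.
    exact: measurable_int (intX 2).
(* The same function is repackaged with codomain [measurableTypeR R], the type used for
   [normal_prob]. *)
have mX : measurable_fun [set: T] (X : T -> measurableTypeR R).
  exact: (@measurable_funPT _ _ _ _ X).
pose Y : {mfun T >-> measurableTypeR R} := HB.pack (X : T -> measurableTypeR R)
  (isMeasurableFun.Build _ _ _ _ _ mX).
have {}lawX B : measurable B -> P (Y @^-1` B) = normal_prob 0 s B.
  by move=> mB; rewrite lawX// /gaussian_law gt_eqF.
split.
- move=> n n4; exact: (law_integrable lawX (normal_prob_integrable_expr s0 n4)).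
- rewrite -[LHS]/(\int[P]_w (Y w)%:E)%E
    (law_integral lawX (normal_prob_integrable_expr s0 (isT : (1 <= 4)%N))).
  exact: normal_prob_mean.
- rewrite -[LHS]/(\int[P]_w (Y w ^+ 2)%:E)%E
    (law_integral lawX (normal_prob_integrable_expr s0 (isT : (2 <= 4)%N))).
  exact: normal_prob_expr2.
Qed.

Section second_moment_of_sum.
Context {d} {T : measurableType d} {R : realType} (P : {measure set T -> \bar R}).

(** In the expanded square only the diagonal terms survive integration. *)
Lemma orthogonal_sum_sqr m (Y : nat -> T -> R) (c : 'I_m -> R) (V : R) :
  (forall i j, P.-integrable setT (fun w => (Y i w * Y j w)%:E)) ->
  (forall i j, i != j -> (\int[P]_w (Y i w * Y j w)%:E = 0)%E) ->
  (forall i, (\int[P]_w (Y i w ^+ 2)%:E <= V%:E)%E) ->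
  (\int[P]_w ((\sum_(i < m) c i * Y i w) ^+ 2)%:E <=
   (V * \sum_(i < m) c i ^+ 2)%:E)%E.
Proof.
move=> intY orthY varY.
under eq_integral => w _.
  rewrite expr2 big_distrlr/= -sumEFin.
  under eq_bigr => i _.
    rewrite -sumEFin; under eq_bigr do rewrite mulrACA EFinM.
    over.
  over.
rewrite /= integral_sum//; last first.
  by move=> i; apply: integrable_sum => // j _; apply: integrableZl.
rewrite mulr_sumr -sumEFin; apply: lee_sum => i _.
rewrite integral_sum//; last by move=> j; apply: integrableZl.
rewrite (bigD1 i)//= big1 ?adde0; last first.
  by move=> j ji; rewrite integralZl// orthY ?mule0// eq_sym.
rewrite integralZl// -expr2 [X in (_ <= X)%E]EFinM muleC.
by rewrite lee_wpmul2r ?lee_fin ?sqr_ge0//; exact: varY.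
Qed.

Lemma ge0_markov (S : T -> R) (K e : R) :
  measurable_fun setT S -> (forall w, 0 <= S w) -> 0 < e ->
  (\int[P]_w (S w)%:E <= K%:E)%E -> (P [set w | (e < S w)%R] <= (K / e)%:E)%E.
Proof.
move=> mS S0 e0 SK.
have mA : measurable [set w | e < S w].
  rewrite -[X in measurable X]setTI; apply: measurable_fun_ltr => //.
rewrite EFinM lee_pdivlMr// muleC; apply: le_trans SK.
rewrite -(setIT [set _ | _]) -integral_indic// -ge0_integralZl ?lee_fin ?(ltW e0)//; last first.
  exact/measurable_EFinP/measurable_indic.
apply: ge0_le_integral => //.
- by move=> w _; rewrite mule_ge0// lee_fin// ltW.
- by apply: emeasurable_funM => //; exact/measurable_EFinP/measurable_indic.
- exact/measurable_EFinP.
move=> w _; rewrite -EFinM lee_fin indicE; have [|_] := boolP (_ \in _).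
  by rewrite inE/= mulr1 => /ltW.
by rewrite mulr0.
Qed.

End second_moment_of_sum.

(** * Mean, variance bound and orthogonality of the noise in the squared ranges *)

Section noise.
Context {d} {T : measurableType d} {R : realType} (P : probability T R).
Variables (s : R) (r : nat -> {RV P >-> R}).
Hypotheses (s0 : 0 <= s) (iid : iid_centered_gaussian s r).
Variables (e : nat -> R) (K : R).
Hypothesis eK : forall i, `|e i| <= K.

(* The error of the i-th squared range, [(e i + r i) ^+ 2 - e i ^+ 2 - s ^+ 2]. *)
Let eta i w := 2 * e i * r i w + r i w ^+ 2 - s ^+ 2.

Let moments i := gaussian_law_moments s0 (iid.2 i).

Let int_r i n : (n <= 4)%N -> P.-integrable setT (fun w => (r i w ^+ n)%:E).
Proof. by case: (moments i) => + _ _; exact. Qed.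

Let int_cst (c : R) : P.-integrable setT (fun=> c%:E).
Proof. exact: finite_measure_integrable_cst. Qed.

Let measurable_eta i : measurable_fun setT (eta i).
Proof.
apply: measurable_funB => //; apply: measurable_funD; first exact: measurable_funM.
exact: measurable_funX.
Qed.

Let eta_def i : (fun w => (eta i w)%:E) =
  ((fun w => (2 * e i)%:E * (r i w ^+ 1)%:E) \+ (fun w => (r i w ^+ 2)%:E) \-
   (fun=> (s ^+ 2)%:E))%E.
Proof. by []. Qed.

Let int_eta i : P.-integrable setT (fun w => (eta i w)%:E).
Proof.
rewrite eta_def; apply: integrableB => //; apply: integrableD => //; last exact: int_r.
by apply: integrableZl => //; exact: int_r.
Qed.

Let mean_eta i : (\int[P]_w (eta i w)%:E = 0)%E.
Proof.
have [_ m1 m2] := moments i.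
rewrite eta_def integralB//; last first.
  apply: integrableD => //; last exact: int_r.
  by apply: integrableZl => //; exact: int_r.
rewrite integralD//; last 2 first.
- by apply: integrableZl => //; exact: int_r.
- exact: int_r.
rewrite integralZl//; last exact: int_r.
rewrite [X in (_ * X)%E]m1 mule0 add0e [X in (X - _)%E]m2 integral_cst//.
by rewrite -[X in (_ - _ * X)%E]/(P setT) probability_setT mule1 subee.
Qed.

Let indep i j : i != j -> forall A B, measurable A -> measurable B ->
  P (r i @^-1` A `&` r j @^-1` B) = (P (r i @^-1` A) * P (r j @^-1` B))%E.
Proof.
move=> ij A B mA mB.
(* Mutual independence is used for the index set [{i, j}], where this family takes the values [A]
   and [B]. *)
pose C k := if k == i then A else B.
have Ci : C i = A by rewrite /C eqxx.
have Cj : C j = B by rewrite /C eq_sym (negbTE ij).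
have := iid.1 [fset i; j]%fset C.
rewrite big_fsetU1 ?inE//= big_seq_fset1 Ci Cj => <-; last by move=> k; rewrite /C; case: ifP.
congr (P _); apply/seteqP; split => w /=.
  by move=> [Aw Bw] k /=; rewrite !inE => /orP[] /eqP ->; rewrite /= ?Ci ?Cj.
move=> h; split.
  by have := h i; rewrite /= !inE eqxx Ci => /(_ isT).
by have := h j; rewrite /= !inE eqxx orbT Cj => /(_ isT).
Qed.

Let eta_pair i j : i != j ->
  P.-integrable setT (fun w => (eta i w * eta j w)%:E) /\
  (\int[P]_w (eta i w * eta j w)%:E = 0)%E.
Proof.
move=> ij.
have mg k : measurable_fun setT (fun x : R => 2 * e k * x + x ^+ 2 - s ^+ 2).
  apply: measurable_funB => //; apply: measurable_funD; first exact: measurable_funM.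
  exact: measurable_funX.
have [? E] := independent_integralM (indep ij) (mg i) (mg j) (int_eta i) (int_eta j).
by split => //; rewrite E mean_eta mul0e.
Qed.

(** This is [(p + q + t) ^+ 2 <= 3 * (p ^+ 2 + q ^+ 2 + t ^+ 2)] for the three terms of [eta], with
    [|e i| <= K]. The squares supplied to [nra] are those of the pairwise differences of the
    terms. *)
Let eta_bound i w :
  eta i w ^+ 2 <= 12 * K ^+ 2 * r i w ^+ 2 + 3 * r i w ^+ 4 + 3 * s ^+ 4.
Proof.
have K0 : 0 <= K by exact: le_trans (eK i).
have : e i ^+ 2 <= K ^+ 2.
  by rewrite -[e i ^+ 2]ger0_norm ?sqr_ge0// normrX lerXn2r ?nnegrE.
have := sqr_ge0 (r i w); rewrite /eta; move: (r i w) (e i) => x y.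
move=> x2 yK.
have h : y ^+ 2 * x ^+ 2 <= K ^+ 2 * x ^+ 2 by rewrite ler_wpM2r.
have := sqr_ge0 (2 * y * x - x ^+ 2).
have := sqr_ge0 (2 * y * x + s ^+ 2).
have := sqr_ge0 (x ^+ 2 + s ^+ 2).
rewrite (_ : x ^+ 4 = (x ^+ 2) ^+ 2) ?(exprM x 2 2)//.
rewrite (_ : s ^+ 4 = (s ^+ 2) ^+ 2) ?(exprM s 2 2)//.
move: (s ^+ 2) => z; nra.
Qed.

Let bound_def i : (fun w => (12 * K ^+ 2 * r i w ^+ 2 + 3 * r i w ^+ 4 + 3 * s ^+ 4)%:E) =
  ((fun w => (12 * K ^+ 2)%:E * (r i w ^+ 2)%:E) \+ (fun w => 3%:E * (r i w ^+ 4)%:E) \+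
   (fun=> (3 * s ^+ 4)%:E))%E.
Proof. by []. Qed.

Let int_bound i : P.-integrable setT
  (fun w => (12 * K ^+ 2 * r i w ^+ 2 + 3 * r i w ^+ 4 + 3 * s ^+ 4)%:E).
Proof.
rewrite bound_def; apply: integrableD => //; apply: integrableD => //.
  by apply: integrableZl => //; exact: int_r.
by apply: integrableZl => //; exact: int_r.
Qed.

Let int_eta_sqr i : P.-integrable setT (fun w => (eta i w ^+ 2)%:E).
Proof.
apply: le_integrable (int_bound i) => //.
  by apply/measurable_EFinP; exact: measurable_funX.
move=> w _ /=; rewrite lee_fin !ger0_norm ?sqr_ge0//.
exact: le_trans (sqr_ge0 _) (eta_bound i w).
Qed.

(** The [eta i] need not have the same law, as [e i] varies, but the dominating functions of
    [eta_bound] do. Hence the integral of the one with index 0 bounds all the variances. *)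
Lemma noise_orthogonal : exists V : R,
  [/\ 0 <= V,
      forall i j, P.-integrable setT (fun w => (eta i w * eta j w)%:E),
      forall i j, i != j -> (\int[P]_w (eta i w * eta j w)%:E = 0)%E &
      forall i, (\int[P]_w (eta i w ^+ 2)%:E <= V%:E)%E].
Proof.
exists (fine (\int[P]_w (12 * K ^+ 2 * r 0 w ^+ 2 + 3 * r 0 w ^+ 4 + 3 * s ^+ 4)%:E)).
split.
- rewrite fine_ge0// integral_ge0// => w _; rewrite lee_fin.
  exact: le_trans (sqr_ge0 _) (eta_bound 0 w).
- move=> i j; have [->|/eta_pair[]//] := eqVneq i j.
  exact (int_eta_sqr j).
- by move=> i j /eta_pair[].
move=> i; rewrite fineK ?(integrable_fin_num measurableT (int_bound 0))//.
have -> : (\int[P]_w (12 * K ^+ 2 * r 0 w ^+ 2 + 3 * r 0 w ^+ 4 + 3 * s ^+ 4)%:E =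
    \int[P]_w (12 * K ^+ 2 * r i w ^+ 2 + 3 * r i w ^+ 4 + 3 * s ^+ 4)%:E)%E.
  pose h (x : R) := (12 * K ^+ 2 * x ^+ 2 + 3 * x ^+ 4 + 3 * s ^+ 4)%:E.
  have mh : measurable_fun setT h.
    apply/measurable_EFinP; apply: measurable_funD => //.
    by apply: measurable_funD => //; apply: measurable_funM => //; exact: measurable_funX.
  apply/esym; rewrite (@law_integral _ _ _ _ _ P (r i) (distribution P (r 0)) _ h).
  - by rewrite integral_distribution//; exact: int_bound.
  - by move=> B mB; rewrite iid.2// -(iid.2 0).
  - by apply: integrable_pushforward => //; exact: int_bound.
apply: le_integral => //.
by move=> w _; rewrite lee_fin eta_bound.
Qed.

End noise.

(** * Weak convergence and empirical frequencies *)

Section weak_convergence.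
Context {R : realType} {n : nat}.
Implicit Types (x p q z : 'cV[R]_n) (S U : set 'cV[R]_n).

Lemma borel_open U : open U -> measurable (U : set (borelType R n)).
Proof. by move=> oU; exact: sub_sigma_algebra. Qed.

Lemma measurable_coord (k : 'I_n) :
  measurable_fun [set: borelType R n] (fun x : borelType R n => (x : 'cV[R]_n) k 0).
Proof.
apply: (measurability _ (RGenOInfty.measurableE R)) => _ [_ [t ->]] <-.
rewrite setTI; apply: borel_open.
apply: open_comp; last exact: interval_open.
by move=> x _; exact: coord_continuous.
Qed.

Lemma measurable_coord_itv (k : 'I_n) (i : interval R) :
  measurable ([set x : 'cV[R]_n | x k 0 \in i] : set (borelType R n)).
Proof.
rewrite -[X in measurable X]setTI.
exact: (@measurable_coord k measurableT [set` i] (measurable_itv i)).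
Qed.

Definition sample_freq (a : nat -> 'cV[R]_n) (m : nat) S : R :=
  #|[pred i : 'I_m | a i \in S]|%:R / m%:R.

Lemma sample_df_freq (a : nat -> 'cV[R]_n) m z :
  sample_df a m z = sample_freq a m [set x | cle x z].
Proof.
rewrite /sample_df /sample_freq; congr (_%:R / _); apply: eq_card => i.
by rewrite !inE; apply/idP/idP; rewrite in_setE.
Qed.

Lemma sample_freq_le (a : nat -> 'cV[R]_n) m S U :
  S `<=` U -> sample_freq a m S <= sample_freq a m U.
Proof.
move=> SU; rewrite ler_wpM2r ?invr_ge0// ler_nat; apply: subset_leq_card.
by apply/fintype.subsetP => i; rewrite !inE => /SU.
Qed.

Lemma sample_freqD (a : nat -> 'cV[R]_n) m S U :
  U `<=` S -> sample_freq a m (S `\` U) = sample_freq a m S - sample_freq a m U.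
Proof.
move=> US; rewrite /sample_freq -mulrBl; congr (_ / _).
rewrite -(cardID [pred i : 'I_m | a i \in U] [pred i : 'I_m | a i \in S]) natrD.
rewrite [X in _ = X%:R + _ - _](_ : _ = #|[pred i : 'I_m | a i \in U]|); last first.
  apply: eq_card => i; rewrite !inE; apply/andP/idP => [[]//|Ui].
  by split=> //; rewrite in_setE; apply: US; rewrite -in_setE.
rewrite addrC addKr; congr (_%:R); apply: eq_card => i; rewrite !inE in_setD.
by rewrite andbC.
Qed.

Variable mu : probability (borelType R n) R.

(** A point whose coordinates all satisfy this is a continuity point of the distribution function
    ([atomless_continuous]), so the assumed convergence holds there. *)
Definition atomless_coord (t : R) : Prop :=
  forall k : 'I_n, mu [set x : 'cV[R]_n | x k 0 = t] = 0%E.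

(** An exceptional [t] is an atom of one of the [n] coordinate laws, and each law has countably many
    atoms. *)
Lemma atomful_countable : countable [set t | ~ atomless_coord t].
Proof.
pose X (k : 'I_n) : {RV mu >-> R} :=
  HB.pack (fun x : borelType R n => (x : 'cV[R]_n) k 0)
    (isMeasurableFun.Build _ _ _ _ _ (measurable_coord k)).
apply: (@sub_countable _ _ _ (\bigcup_(k in [set: 'I_n]) [set t | 0 < pmf (X k) t])).
  apply: subset_card_le => t /= /existsNP[k kt]; exists k => //=.
  rewrite /pmf fine_gt0//; apply/andP; split.
    by rewrite lt0e measure_ge0 andbT; apply/eqP.
  exact: (le_lt_trans (probability_le1 _ _) (ltry _)).
by apply: bigcup_countable => // k _; exact: pmf_gt0_countable.
Qed.

(** Otherwise [[0, 1]] would be covered by countably many translates of a countable set and have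
    Lebesgue measure 0. The shifted rationals provide a countable dense supply of admissible
    coordinates. *)
Lemma atomless_shift : exists theta : R, forall q : rat, atomless_coord (theta + ratr q).
Proof.
apply: contrapT => /forallNP H.
have I0 : countable (`[0, 1]%classic : set R).
  apply: (@sub_countable _ _ _ (\bigcup_(q in [set: rat])
     [set t - ratr q | t in [set t | ~ atomless_coord t]])).
    apply: subset_card_le => theta _; have /existsNP[q Hq] := H theta.
    by exists q => //; exists (theta + ratr q) => //; rewrite addrK.
  apply: bigcup_countable => // q _.
  apply: sub_countable atomful_countable; exact: card_image_le.
have := countable_lebesgue_measure0 I0.
rewrite lebesgue_measure_itv/= lte_fin ltr01 oppr0 adde0 => /eqP.
by rewrite eqe oner_eq0.
Qed.

End weak_convergence.

(** * Continuity points of the distribution function *)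

Section convergence_at_continuity_points.
Context {R : realType} {n : nat} (mu : probability (borelType R n) R).
Implicit Types (x p q z : 'cV[R]_n) (U : set 'cV[R]_n).

Lemma measurable_cle z : measurable ([set x | cle x z] : set (borelType R n)).
Proof.
rewrite (_ : [set x | cle x z] =
    \bigcap_(k in [set: 'I_n]) [set x : 'cV[R]_n | x k 0 \in `]-oo, z k 0]]).
  by apply: fin_bigcap_measurable => // k _; exact: measurable_coord_itv.
apply/seteqP; split => x /=.
  by move=> /forallP xz k _; rewrite /= in_itv/=.
by move=> xz; apply/forallP => k; have := xz k I; rewrite /= in_itv.
Qed.

(** For [z'] within [j.+1%:R^-1] of [z], the orthants below [z] and [z'] differ only inside the
    slabs [E k j] around the hyperplanes [x k 0 = z k 0]. The slabs decrease to these null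
    hyperplanes, so their measures tend to 0. *)
Lemma atomless_continuous z : (forall k, atomless_coord mu (z k 0)) ->
  {for z, continuous (distribution_function mu)}.
Proof.
move=> z0.
pose E (k : 'I_n) j : set (borelType R n) :=
  [set x : 'cV[R]_n | x k 0 \in `[z k 0 - j.+1%:R^-1, z k 0 + j.+1%:R^-1]].
have mE k j : measurable (E k j) by exact: measurable_coord_itv.
have E0 k : mu (E k j) @[j --> \oo] --> 0%E.
  rewrite -(z0 k k) (_ : [set x | _] = \bigcap_j E k j).
    apply: nonincreasing_cvg_mu => //.
    - exact: (le_lt_trans (probability_le1 _ _) (ltry _)).
    - exact: bigcap_measurable.
    - move=> i j ij; apply/subsetPset => x; rewrite /E /= !in_itv/= => /andP[zx xz].
      have ji : j.+1%:R^-1 <= i.+1%:R^-1 :> R by rewrite lef_pV2 ?posrE// ler_nat.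
      rewrite (le_trans _ zx) ?lerD2l ?lerN2//.
      by rewrite (le_trans xz)// lerD2l.
  apply/seteqP; split => x /=.
    by move=> xz j _; rewrite /E/= in_itv/= xz lerBlDr lerDl andbb.
  move=> xE; apply/eqP; rewrite -subr_eq0 -normr_eq0; apply: contraT => xz.
  have xz0 : 0 < `|x k 0 - z k 0| by rewrite lt_neqAle eq_sym xz/=.
  have [j] := ltr_add_invr xz0; rewrite add0r => jx.
  by have := xE j I; rewrite /E/= in_itv/= -ler_distl leNgt jx.
apply/(@cvgrPdist_le _ _ _ (nbhs z)) => e e0.
(* The [n] slabs share [e] equally; [n.+1] keeps the denominator positive. *)
have c0 : 0 < e / n.+1%:R by rewrite divr_gt0.
have [j jE] : exists j, forall k, (mu (E k j) < (e / n.+1%:R)%:E)%E.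
  suff /filter_ex : \forall j \near \oo, forall k, (mu (E k j) < (e / n.+1%:R)%:E)%E by [].
  apply: filter_forall => k.
  have : nbhs (0%E : \bar R) (fun u => (u < (e / n.+1%:R)%:E)%E).
    by apply: open_ereal_lt'; rewrite lte_fin.
  by move=> /(E0 k).
pose EU : set (borelType R n) := \bigcup_(k in [set: 'I_n]) E k j.
have mU : measurable EU.
  by apply: fin_bigcup_measurable => // k _; exact: mE.
have UE : (mu EU <= e%:E)%E.
  apply: (@le_trans _ _ (\sum_(k \in [set: 'I_n]) mu (E k j))%E).
    by apply: content_sub_fsum => //; exact: finite_finset.
  rewrite (fsbigE (index_enum 'I_n)) ?index_enum_uniq//; last first.
    by move=> k _; rewrite mem_index_enum.
  under eq_bigl do rewrite in_setT.
  apply: (@le_trans _ _ (\sum_(k < n) (e / n.+1%:R)%:E)%E).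
    by apply: lee_sum => k _; exact/ltW.
  rewrite sumEFin lee_fin sumr_const card_ord -[X in X <= _]mulr_natr.
  by rewrite mulrAC ler_pdivrMr// ler_pM2l// ler_nat.
(* Letting either point be [z] makes this one-sided estimate serve for both inequalities. *)
have close (x y : 'cV[R]_n) : (forall k, `|x k 0 - y k 0| <= j.+1%:R^-1) ->
    (forall k, x k 0 = z k 0) \/ (forall k, y k 0 = z k 0) ->
    distribution_function mu x <= distribution_function mu y + e.
  move=> xy xyz.
  have fin_mu w : mu [set v | cle v w] \is a fin_num.
    by apply: fin_num_measure; exact: measurable_cle.
  rewrite -lee_fin EFinD !fineK//.
  have sub : [set w | cle w x] `<=` [set w | cle w y] `|` EU.
    move=> w /= /forallP wx; have [wy|] := boolP (cle w y); first by left.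
    rewrite negb_forall => /existsP[k]; rewrite -ltNge => yw.
    right; exists k => //; rewrite /E/= in_itv/=.
    have := wx k; have := xy k; rewrite ler_distl => /andP[h1 h2] h3.
    have j0 : 0 <= j.+1%:R^-1 :> R by rewrite invr_ge0.
    case: xyz => /(_ k) <-; apply/andP; split.
    - by rewrite lerBlDr (le_trans h2)// lerD2r ltW.
    - by rewrite (le_trans h3)// lerDl.
    - by rewrite lerBlDr (le_trans (ltW yw))// lerDl.
    - exact: le_trans h3 h2.
  apply: (le_trans (le_measure mu _ _ sub)).
  - by rewrite inE; exact: measurable_cle.
  - by rewrite inE; apply: measurableU => //; exact: measurable_cle.
  apply: (le_trans (measureU2 _ _ _)) => //; first exact: measurable_cle.
  by rewrite leeD2l.
have znear : \forall z' \near z, forall k, `|z k 0 - (z' : 'cV[R]_n) k 0| <= j.+1%:R^-1.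
  apply: (@filter_forall _ _ (fun k => [set z' : 'cV[R]_n | `|z k 0 - z' k 0| <= j.+1%:R^-1])
    (nbhs z)) => k.
  have /cvgrPdist_le := @coord_continuous R n 1 k 0 z.
  by apply; rewrite invr_gt0.
apply: filterS znear => z' zz'.
rewrite ler_distl lerBlDr; apply/andP; split.
  by apply: close; [move=> k; rewrite distrC; exact: zz'|right].
by apply: close; [exact: zz'|left].
Qed.
End convergence_at_continuity_points.

(** * From orthants to boxes and open sets *)

Section portmanteau.
Context {R : realType} {n : nat} (mu : probability (borelType R n) R).
Variable a : nat -> 'cV[R]_n.
Hypothesis cvg_df : forall z : 'cV[R]_n,
  {for z, continuous (distribution_function mu)} ->
  sample_df a m z @[m --> \oo] --> distribution_function mu z.
Implicit Types (x p q z : 'cV[R]_n) (U : set 'cV[R]_n).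

(* The bounds [p k < x k] are only imposed on the first [j] coordinates, so
   that the interpolation from orthants to boxes goes by induction on [j]. *)
Definition half_box (j : nat) p q : set 'cV[R]_n :=
  [set x | forall k : 'I_n, ((k < j)%N -> p k 0 < x k 0) /\ x k 0 <= q k 0].

(** Imposing [p j < x j] removes the points with [x j <= p j], which form the box with its upper
    corner lowered to [p j] in coordinate [j]. *)
Lemma half_boxS (j : 'I_n) p q :
  half_box j.+1 p q =
  half_box j p q `\` half_box j p (\col_k if k == j then p k 0 else q k 0).
Proof.
apply/seteqP; split => x /=.
  move=> xb; split.
    by move=> k; have [h ?] := xb k; split=> // kj; exact/h/ltnW.
  by move=> /(_ j)[_]; rewrite mxE eqxx leNgt (xb j).1.
move=> [xb xN] k; have [h xq] := xb k; split => // kj.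
have [{}kj|jk|/val_inj kj1] := ltngtP k j; first exact: h.
  by move: kj; rewrite ltnS leqNgt jk.
rewrite {}kj1 in xq h kj *; rewrite ltNge; apply/negP => xp; apply: xN => i.
have [hi xi] := xb i; split=> //; rewrite mxE; case: ifPn => [/eqP ->|] //.
Qed.

(** At [j = 0] the box is an orthant at a continuity point. The induction step takes a difference of
    nested boxes, on which measure and frequency both subtract; [q] is generalized because its
    coordinates get replaced by those of [p]. *)
Lemma half_box_cvg (j : nat) p q : (j <= n)%N ->
  (forall k, p k 0 <= q k 0) ->
  (forall k, atomless_coord mu (p k 0)) -> (forall k, atomless_coord mu (q k 0)) ->
  measurable (half_box j p q : set (borelType R n)) /\
  sample_freq a m (half_box j p q) @[m --> \oo] --> fine (mu (half_box j p q)).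
Proof.
move=> jn pq p0; elim: j jn q pq => [|j IH] jn q pq q0.
  have -> : half_box 0 p q = [set x | cle x q].
    apply/seteqP; split => x /=; first by move=> xq; apply/forallP => k; have [] := xq k.
    by move=> /forallP xq k; split => //; exact: xq.
  split; first exact: measurable_cle.
  rewrite -[fine _]/(distribution_function mu q).
  under eq_fun do rewrite -sample_df_freq.
  exact/cvg_df/atomless_continuous.
have [mB1 cB1] := IH (ltnW jn) q pq q0.
pose q' : 'cV[R]_n := \col_k if k == Ordinal jn then p k 0 else q k 0.
have q'E k : q' k 0 = if k == Ordinal jn then p k 0 else q k 0 by rewrite mxE.
have [||mB2 cB2] := IH (ltnW jn) q'.
- by move=> k; rewrite q'E; case: ifP.
- by move=> k; rewrite q'E; case: ifP.
have sub : half_box j p q' `<=` half_box j p q.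
  move=> x xb k; have [h xq'] := xb k; split => //; apply: le_trans xq' _.
  by rewrite q'E; case: ifP.
rewrite (half_boxS (Ordinal jn)) -/q' /=; split; first exact: measurableD.
rewrite measureD//; last by rewrite ltey_eq fin_num_measure.
rewrite setIidr// fineB ?fin_num_measure//.
under eq_fun do rewrite sample_freqD//.
exact: cvgB.
Qed.

(** The frequencies of a box inside [U] converge, yet fall below any [e] at arbitrarily late [m], so
    their limit vanishes. Taking corners on the shifted rational grid keeps the family of boxes
    countable. *)
Lemma freq_small_null U : open U ->
  (forall (e : R) (M : nat), 0 < e -> exists2 m, (M < m)%N & sample_freq a m U < e) ->
  mu U = 0%E.
Proof.
move=> oU small.
have [theta thetaP] := atomless_shift mu.
pose corner (v : 'cV[rat]_n) : 'cV[R]_n := \col_k (theta + ratr (v k 0)).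
have cornerE v k : corner v k 0 = theta + ratr (v k 0) by rewrite mxE.
pose box (v : 'cV[rat]_n * 'cV[rat]_n) := half_box n (corner v.1) (corner v.2).
pose good (v : 'cV[rat]_n * 'cV[rat]_n) :=
  (forall k, corner v.1 k 0 <= corner v.2 k 0) /\ box v `<=` U.
have box_null v : good v -> mu.-negligible (box v : set (borelType R n)).
  move=> [v12 vU].
  have atomless w k : atomless_coord mu (corner w k 0) by rewrite cornerE.
  have [mB cB] := half_box_cvg (leqnn n) v12 (atomless v.1) (atomless v.2).
  have fB := fin_num_measure mu _ mB.
  apply/negligibleP => //.
  rewrite -(fineK fB); congr (_%:E); apply/eqP; rewrite eq_le fine_ge0// andbT.
  rewrite leNgt; apply/negP => B0.
  have half : fine (mu (box v)) / 2 < fine (mu (box v)).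
    by rewrite ltr_pdivrMr// ltr_pMr// ltr1n.
  have [M _ HM] := cvgr_gt _ cB _ half.
  have [|m Mm fm] := small (fine (mu (box v)) / 2) M; first by rewrite divr_gt0.
  have := HM m (ltnW Mm); rewrite /= ltNge => /negP; apply.
  exact: le_trans (sample_freq_le _ _ vU) (ltW fm).
apply: measure_negligible; first exact: borel_open.
(* Pairs of rational corners are enumerated by their codes; an invalid code or a bad box contributes
   the empty set. *)
pose F i : set (borelType R n) := if choice.unpickle i is Some v then
  if `[< good v >] then box v else set0 else set0.
apply: (@negligibleS _ (borelType R n) R mu (\bigcup_i F i)); last first.
  apply: negligible_bigcup => i; rewrite /F.
  case: (choice.unpickle i) => [v|]; last exact: negligible_set0.
  by case: asboolP => [/box_null//|_]; exact: negligible_set0.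
suff cover (x : 'cV[R]_n) : U x -> (\bigcup_i F i) x by move=> x /cover.
move=> Ux; have [e /= e0 eU] : exists2 e : R, 0 < e & ball x e `<=` U.
  by have /nbhs_ballP[e e0 eU] := open_nbhs_nbhs (conj oU Ux); exists e.
have e20 : 0 < e / 2 by rewrite divr_gt0.
(* Grid corners are chosen within [e / 2] of [x] on either side in each coordinate. Balls are those
   of the sup norm, so the resulting box stays inside the ball. *)
have /choice[p pP] (k : 'I_n) : exists q : rat,
    ratr q \in `](x k 0 - theta - e / 2), (x k 0 - theta)[.
  by apply: rat_in_itvoo; rewrite ltrBlDr ltrDl.
have /choice[q qP] (k : 'I_n) : exists q : rat,
    ratr q \in `]x k 0 - theta, x k 0 - theta + e / 2[.
  by apply: rat_in_itvoo; rewrite ltrDl.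
pose v : 'cV[rat]_n * 'cV[rat]_n := (\col_k p k, \col_k q k).
have v1 k : corner v.1 k 0 = theta + ratr (p k) by rewrite cornerE mxE.
have v2 k : corner v.2 k 0 = theta + ratr (q k) by rewrite cornerE mxE.
have vx k : corner v.1 k 0 < x k 0 < corner v.2 k 0.
  have := pP k; have := qP k; rewrite !in_itv/= => /andP[q1 q2] /andP[p1 p2].
  by rewrite v1 v2; apply/andP; split; lra.
have xv : box v x.
  by move=> k; have /andP[x1 x2] := vx k; split => //; exact: ltW.
exists (choice.pickle v) => //; rewrite /F choice.pickleK; case: asboolP => //; case; split.
  by move=> k; have /andP[x1 x2] := vx k; exact/ltW/(lt_trans x1).
move=> y yv; apply: eU; split => // i j; rewrite ord1.
have [/(_ (ltn_ord i)) y1 y2] := yv i.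
rewrite v1 in y1; rewrite v2 in y2.
have := pP i; have := qP i; rewrite !in_itv/= => /andP[q1 q2] /andP[p1 p2].
rewrite /ball/= ltr_distl; apply/andP; split; lra.
Qed.

End portmanteau.

(** * The Gram matrix *)

Lemma coord_le_norm (R : realDomainType) p q (M : 'M[R]_(p, q)) i j :
  `|M i j| <= `|M|.
Proof.
rewrite [leRHS]/Num.norm/= mx_normrE.
by apply/bigmax_geP; right; exists (i, j).
Qed.

Lemma norm_le_coord (R : realDomainType) p q (M : 'M[R]_(p, q)) (c : R) :
  0 <= c -> (forall i j, `|M i j| <= c) -> `|M| <= c.
Proof.
move=> c0 Mc; rewrite [leLHS]/Num.norm/= mx_normrE.
by apply/bigmax_leP; split => // ij _; exact: Mc.
Qed.

Lemma norm_trmx (R : realDomainType) p q (M : 'M[R]_(p, q)) : `|M^T| = `|M|.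
Proof.
apply/eqP; rewrite eq_le; apply/andP; split.
  by apply: norm_le_coord => // i j; rewrite mxE coord_le_norm.
by apply: norm_le_coord => // i j; rewrite -[M]trmxK mxE trmxK coord_le_norm.
Qed.

Section sensor_form.
Context {R : realType} {n : nat}.
Implicit Types (x : 'cV[R]_n) (v : 'cV[R]_(n + 1)).

(* The entry of [A v] for a sensor at [x]. *)
Definition sensor_form v x : R :=
  (row_mx (- 2%:R *: x^T) (const_mx 1) *m v) 0 0.

Lemma BEL_A_mul (a : nat -> 'cV[R]_n) m v (i : 'I_m) :
  (BEL_A a m *m v) i 0 = sensor_form v (a i).
Proof.
rewrite /sensor_form !mxE; apply: eq_bigr => j _; congr (_ * _).
by rewrite /BEL_A mxE.
Qed.

Lemma sensor_formE v x :
  sensor_form v x = - 2 * ((usubmx v)^T *m x) 0 0 + dsubmx v 0 0.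
Proof.
rewrite /sensor_form -[v in LHS]vsubmxK mul_row_col mxE; congr (_ + _).
  rewrite -scalemxAl mxE; congr (_ * _).
  by rewrite -[in RHS](trmxK ((usubmx v)^T *m x)) [RHS]mxE trmx_mul trmxK.
by rewrite mxE big_ord1 mxE mul1r.
Qed.

Lemma sensor_form_linear v1 v2 x :
  sensor_form v1 x - sensor_form v2 x = sensor_form (v1 - v2) x.
Proof. by rewrite /sensor_form mulmxBr [RHS]mxE; congr (_ + _); rewrite [RHS]mxE. Qed.

Lemma sensor_formZ c v x : sensor_form (c *: v) x = c * sensor_form v x.
Proof. by rewrite /sensor_form -scalemxAr mxE. Qed.

Lemma sensor_form_continuous v : continuous (sensor_form v).
Proof.
move=> x.
rewrite (_ : sensor_form v =
    fun x => - 2 * (\sum_k usubmx v k 0 * x k 0) + dsubmx v 0 0); last first.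
  apply/funext => y; rewrite sensor_formE mxE; congr (_ * _ + _).
  by apply: eq_bigr => k _; rewrite mxE.
have cst (c : R) : c @[y --> x] --> c by exact: (@cvg_cst R c _ (nbhs x)).
apply: (@cvgD _ R^o _ (nbhs x)) => //; apply: (@cvgMl_tmp _ _ (nbhs x)).
elim: (index_enum _) => [|k s IH].
  rewrite big_nil; under eq_fun do rewrite big_nil.
  exact: cst.
rewrite big_cons; under eq_fun do rewrite big_cons.
apply: (@cvgD _ R^o _ (nbhs x)) => //; apply: (@cvgMl_tmp _ _ (nbhs x)).
exact: coord_continuous.
Qed.

Lemma sensor_form_bound v x (K : R) : `|x| <= K ->
  `|sensor_form v x| <= (1 + 2 * K) *+ (n + 1) * `|v|.
Proof.
move=> xK; rewrite /sensor_form mxE.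
have K0 : 0 <= K by exact: le_trans xK.
apply: le_trans (ler_norm_sum _ _ _) _.
apply: (@le_trans _ _ (\sum_(j < n + 1) (1 + 2 * K) * `|v|)); last first.
  by rewrite sumr_const card_ord [leRHS]mulrnAl.
apply: ler_sum => j _; rewrite normrM ler_pM ?coord_le_norm//.
rewrite mxE; case: splitP => k _; rewrite !mxE.
  have := coord_le_norm x k 0; rewrite normrM normrN normr_nat; lra.
by rewrite normr1 lerDl mulr_ge0.
Qed.

(** The zero set is a translate of the kernel of [x |-> w^T x], of dimension [n - 1] by
    rank-nullity. The base point [p] solves [2 * w^T p = dsubmx v] along a basis vector on which [w]
    does not vanish. *)
Lemma sensor_form_flat v : usubmx v != 0 ->
  affine_flat n.-1 [set x | sensor_form v x = 0].
Proof.
set w := usubmx v => w0.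
have [k wk] : exists k, w k 0 != 0.
  apply: contrapT => /forallNP h; move/eqP: w0; apply.
  by apply/colP => k; rewrite [RHS]mxE; apply/eqP; apply: contrapT => /negP; exact: h.
pose f := linfun (mulmx w^T : 'cV[R]_n -> 'cV[R]_1).
pose p : 'cV[R]_n := (dsubmx v 0 0 / (2 * w k 0)) *: delta_mx k 0.
have fE y : f y = w^T *m y by rewrite lfunE.
have sE y : sensor_form v y = - 2 * (f y) 0 0 + dsubmx v 0 0.
  by rewrite sensor_formE fE.
have fp : (f p) 0 0 = dsubmx v 0 0 / 2.
  rewrite fE /p -scalemxAr [LHS]mxE -colE (_ : col k w^T 0 0 = w k 0); last by rewrite !mxE.
  by field.
exists p, (lker f); split.
  have f1 : \dim (limg f) = 1%N.
    apply/eqP; rewrite eqn_leq lt0n dimv_eq0; apply/andP; split.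
      by rewrite (leq_trans (dimvS (subvf _)))// dimvf dim_matrix.
    apply: contra wk => /eqP f0.
    have : f (delta_mx k 0) \in limg f by rewrite memv_img// memvf.
    rewrite f0 memv0 fE -colE => /eqP/matrixP/(_ 0 0).
    by rewrite !mxE => ->.
  have := limg_ker_dim f fullv; rewrite capfv f1 dimvf dim_matrix.
  rewrite addn1 => /(congr1 predn) /= ->; congr predn; exact: muln1.
apply/seteqP; split => x /=.
  rewrite sE => fx; exists (x - p); last by rewrite addrC subrK.
  rewrite /= memv_ker linearB/=; apply/eqP/colP => i; rewrite ord1 !mxE.
  rewrite fp; lra.
move=> [y]; rewrite memv_ker => /eqP y0 <-.
by rewrite sE fE mulmxDr -!fE y0 addr0 fp; field.
Qed.

End sensor_form.

(** * A lower bound on the quadratic form, uniform in the direction *)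

Section gram_lower_bound.
Context {R : realType} {n : nat} (mu : probability (borelType R n) R).
Variables (a : nat -> 'cV[R]_n) (K : R).
Hypothesis cvg_df : forall z : 'cV[R]_n,
  {for z, continuous (distribution_function mu)} ->
  sample_df a m z @[m --> \oo] --> distribution_function mu z.
Hypothesis aK : forall i, `|a i| <= K.
Hypothesis not_flat : forall S : set 'cV[R]_n, affine_flat n.-1 S -> mu S <> 1%E.

Lemma sensor_form_gt_open (v : 'cV[R]_(n + 1)) (e : R) : open [set x | e < `|sensor_form v x|].
Proof.
rewrite (_ : [set x | _] = (fun x => `|sensor_form v x|) @^-1` `]e, +oo[).
  apply: open_comp; last exact: interval_open.
  move=> x _; apply: (@cvg_norm _ R^o _ (nbhs x)); exact: sensor_form_continuous.
by apply/seteqP; split => x; rewrite /= in_itv/= andbT.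
Qed.

Lemma sensor_form_spread (v : 'cV[R]_(n + 1)) : v != 0 ->
  exists e : R, 0 < e /\ exists M : nat, forall m, (M < m)%N ->
    e <= sample_freq a m [set x | e < `|sensor_form v x|].
Proof.
move=> v0; apply: contrapT => /forallNP H.
pose U (j : nat) := [set x : 'cV[R]_n | j.+1%:R^-1 < `|sensor_form v x|].
have U0 j : mu (U j) = 0%E.
  apply: (freq_small_null cvg_df); first exact: sensor_form_gt_open.
  (* One number is both the threshold for the form and the proportion of sensors; shrinking it
     weakens both requirements, so the minimum contradicts [H]. *)
  move=> e M e0; apply: contrapT => /forall2NP h; apply: (H (Num.min e j.+1%:R^-1)).
  split; first by rewrite lt_min e0 invr_gt0 ltr0n.
  exists M => m Mm; rewrite ge_min; apply/orP; left.
  have [/(_ Mm)//|/negP] := h m; rewrite -leNgt => /le_trans; apply.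
  apply: sample_freq_le => x; rewrite /U /= => /(le_lt_trans _); apply.
  by rewrite ge_min lexx orbT.
pose Z : set (borelType R n) := [set x : 'cV[R]_n | sensor_form v x = 0].
have ZC : (~` Z) = \bigcup_j (U j : set (borelType R n)).
  apply/seteqP; split => x /=.
    move=> /eqP; rewrite -normr_gt0 => /ltr_add_invr[i]; rewrite add0r => ix.
    by exists i.
  by move=> [j _ jx] x0; move: jx; rewrite /U/= x0 normr0 ltNge invr_ge0 ler0n.
have ZC0 : mu.-negligible (~` Z).
  rewrite ZC; apply: negligible_bigcup => i; apply/negligibleP; last exact: U0.
  by apply: borel_open; exact: sensor_form_gt_open.
have mZC : measurable (~` Z).
  rewrite ZC; apply: bigcupT_measurable => i.
  by apply: borel_open; exact: sensor_form_gt_open.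
have mZ : measurable Z by rewrite -(setCK Z); exact: measurableC.
have muZ : mu Z = 1%E.
  have h : (1 - mu Z = 0)%E.
    exact: etrans (esym (probability_setC mu mZ)) (measure_negligible mZC ZC0).
  have fZ : mu Z \is a fin_num by apply: fin_num_measure.
  by move: h; rewrite -(fineK fZ) -EFinB => -[] /eqP; rewrite subr_eq0 => /eqP <-.
(* With a nonzero linear part, [Z] is a hyperplane, excluded by [not_flat]. Otherwise the form is a
   nonzero constant and [Z] is empty. *)
have [w0|w0] := eqVneq (usubmx v) 0; last first.
  exact: (not_flat (sensor_form_flat w0)) muZ.
suff Z0 : Z = set0 by move/eqP: muZ; rewrite Z0 measure0 eqe eq_sym oner_eq0.
apply/seteqP; split => // x; rewrite /Z /= sensor_formE w0 trmx0 mul0mx mxE mulr0 add0r => t0.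
move/eqP: v0; apply; rewrite -(vsubmxK v) w0.
rewrite (_ : dsubmx v = 0) ?col_mx0//; apply/matrixP => i j.
by rewrite !ord1 t0 mxE.
Qed.

Lemma sensor_form_uniform : exists (c : R) (M : nat), 0 < c /\
  forall m, (M <= m)%N -> forall v : 'cV[R]_(n + 1),
    c * m%:R * `|v| ^+ 2 <= \sum_(i < m) sensor_form v (a i) ^+ 2.
Proof.
pose Sph := [set u : 'rV[R]_(n + 1) | `|u| = 1].
have cS : compact Sph.
  apply: bounded_closed_compact.
    by exists 1; split => // M M1 u /= ->; exact: ltW.
  rewrite (_ : Sph = (fun u : 'rV[R]_(n + 1) => `|u|) @^-1` [set 1 : R])//.
  by apply: closed_comp; [move=> u _; exact: norm_continuous|exact: closed_eq].
have K0 : 0 <= K by exact: le_trans (aK 0).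
pose C := (1 + 2 * K) *+ (n + 1).
have C0 : 0 <= C by rewrite mulrn_wge0// addr_ge0// mulr_ge0.
(* A single [N] gives both the constant [N.+1%:R^-1] and the rank from which the bound holds. This
   puts the local statement in the form required by near-covering compactness. *)
have := (iffLR (compact_near_coveringP Sph) cS) nat \oo
  (fun N u => forall m, (N <= m)%N ->
     N.+1%:R^-1 * m%:R <= \sum_(i < m) sensor_form u^T (a i) ^+ 2) _.
case.
  move=> u Su.
  have u0 : u^T != 0.
    by rewrite -normr_eq0 norm_trmx Su oner_eq0.
  have [e [e0 [M HM]]] := sensor_form_spread u0.
  (* Moving [u] by this radius changes the form by at most [e / 2] at every sensor. The at least
     [e * m] sensors with value above [e] keep at least [e / 2], so the sum is at least
     [e ^+ 3 / 4 * m]. *)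
  have D0 : 0 < e / 2 / (C + 1) by rewrite !divr_gt0// ltr_pwDr.
  exists (ball u (e / 2 / (C + 1)), [set N | (M < N)%N /\ N.+1%:R^-1 <= e ^+ 3 / 4]).
    split => /=.
      exact: nbhsx_ballx.
    have [N0 HN0] := ltr_add_invr (divr_gt0 (exprn_gt0 3 e0) (ltr0Sn R 3)).
    exists (maxn M.+1 N0) => // N /=; rewrite geq_max => /andP[MN NN0]; split => //.
    apply: le_trans (ltW HN0); rewrite add0r lef_pV2 ?posrE// ler_nat.
    exact: leq_trans NN0 _.
  move=> [u' N] /= [uu' [MN Ne]] m Nm.
  have := HM m (leq_trans MN Nm) => freq.
  have m0 : 0 < m%:R :> R by rewrite ltr0n (leq_ltn_trans _ (leq_trans MN Nm)).
  have close i : `|sensor_form u^T (a i) - sensor_form u'^T (a i)| <= e / 2.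
    rewrite sensor_form_linear (le_trans (sensor_form_bound _ (aK i)))// -/C.
    rewrite -linearB/= norm_trmx.
    have uu'W : `|u - u'| <= e / 2 / (C + 1).
      by apply: ltW; move: uu'; rewrite mx_norm_ball.
    rewrite (le_trans (ler_wpM2l C0 uu'W))// mulrCA -[leRHS]mulr1 ler_pM2l ?divr_gt0//.
    by rewrite ler_pdivrMr ?mul1r ?lerDl// ltr_pwDr.
  pose B := [pred i : 'I_m | a i \in [set x | e < `|sensor_form u^T x|]].
  have big i : i \in B -> e ^+ 2 / 4 <= sensor_form u'^T (a i) ^+ 2.
    rewrite !inE /= => ei; have := close i; move: ei.
    set s := sensor_form u^T _; set s' := sensor_form u'^T _ => es ss'.
    have : e / 2 <= `|s'|.
      by have := ler_normD (s - s') s'; rewrite subrK; lra.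
    move=> es'; rewrite -[leRHS]ger0_norm ?sqr_ge0// normrX.
    have -> : e ^+ 2 / 4 = (e / 2) ^+ 2 by field.
    by rewrite lerXn2r ?nnegrE// divr_ge0// ltW.
  have cardB : e * m%:R <= #|B|%:R by rewrite -ler_pdivlMr.
  apply: (@le_trans _ _ (#|B|%:R * (e ^+ 2 / 4))).
    apply: (@le_trans _ _ (e * m%:R * (e ^+ 2 / 4))); last first.
      by rewrite ler_wpM2r// divr_ge0// sqr_ge0.
    rewrite (_ : e * m%:R * _ = e ^+ 3 / 4 * m%:R); last by field.
    by rewrite ler_wpM2r.
  rewrite mulr_natl -sumr_const big_mkcond/=; apply: ler_sum => i _.
  by case: ifP => [/big//|_]; exact: sqr_ge0.
move=> N _ HN; exists (N.+1%:R^-1), N.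
split; first by rewrite invr_gt0.
move=> m Nm v; have [->|v0] := eqVneq v 0.
  by rewrite normr0 expr0n mulr0 sumr_ge0// => i _; exact: sqr_ge0.
have vn : 0 < `|v| by rewrite normr_gt0.
(* Homogeneity of degree 2 extends the bound from the unit sphere to every [v]. *)
have := HN N (leqnn N) (`|v|^-1 *: v^T).
rewrite /Sph/= normrZ norm_trmx normfV normr_id mulVf ?gt_eqF// => /(_ erefl m Nm).
rewrite linearZ/= trmxK; under eq_bigr do rewrite sensor_formZ exprMn.
by rewrite -mulr_sumr exprVn ler_pdivlMl ?exprn_gt0// mulrC.
Qed.

End gram_lower_bound.

(** * The estimator *)

Lemma enorm_sqr (R : realType) n (x : 'cV[R]_n) : enorm x ^+ 2 = \sum_k x k 0 ^+ 2.
Proof. by rewrite sqr_sqrtr// sumr_ge0// => k _; exact: sqr_ge0. Qed.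

Lemma enorm_le (R : realType) n (x : 'cV[R]_n) (K : R) :
  `|x| <= K -> enorm x <= Num.sqrt (K ^+ 2 *+ n).
Proof.
move=> xK; have K0 : 0 <= K by exact: le_trans xK.
rewrite ler_sqrt; last by rewrite mulrn_wge0// sqr_ge0.
rewrite -[n in leRHS]card_ord -sumr_const; apply: ler_sum => k _.
rewrite -[leLHS]ger0_norm ?sqr_ge0// normrX lerXn2r ?nnegrE//.
exact: le_trans (coord_le_norm _ _ _) xK.
Qed.

(** * Algebra of the least squares solution *)

Section least_squares.
Context {R : realType} {n : nat} (a : nat -> 'cV[R]_n) (c : R) (m : nat).
Hypotheses (c0 : 0 < c) (m0 : (0 < m)%N).
Hypothesis form_ge : forall v : 'cV[R]_(n + 1),
  c * m%:R * `|v| ^+ 2 <= \sum_(i < m) sensor_form v (a i) ^+ 2.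

Let A := BEL_A a m.
Let G := A^T *m A.

Let cm0 : 0 < c * m%:R.
Proof. by rewrite mulr_gt0// ltr0n. Qed.

Let formE v : \sum_(i < m) sensor_form v (a i) ^+ 2 = (v^T *m (G *m v)) 0 0.
Proof.
rewrite /G -!mulmxA mulmxA -trmx_mul mxE; apply: eq_bigr => i _.
by rewrite mxE BEL_A_mul.
Qed.

(** As [G] is symmetric, a row [u] of its kernel makes the quadratic form vanish at [u^T], and
    [form_ge] then forces [u = 0]. *)
Lemma BEL_gram_unit : G \in unitmx.
Proof.
rewrite -row_free_unit -kermx_eq0; apply/eqP/row_matrixP => i; rewrite row0.
set u := row i _; have uG : u *m G = 0 by apply/sub_kermxP; exact: row_sub.
have GT : G^T = G by rewrite /G trmx_mul trmxK.
have Gu : G *m u^T = 0 by rewrite -GT -trmx_mul uG trmx0.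
have := form_ge u^T; rewrite formE Gu mulmx0 mxE.
rewrite pmulr_rle0// => u0.
have /eqP : `|u^T| ^+ 2 = 0 by apply/eqP; rewrite eq_le u0 sqr_ge0.
by rewrite sqrf_eq0 normr_eq0 => /eqP/(congr1 trmx); rewrite trmxK trmx0.
Qed.

(** With [C = G^-1 A^T] one has [C C^T = G^-1], so the sum is the diagonal entry [g] of [G^-1]. For
    its column [v] the quadratic form equals [g], while [g ^+ 2 <= |v| ^+ 2]; so [form_ge] gives
    [c * m * g ^+ 2 <= g]. *)
Lemma BEL_pinv_row_sqr (k : 'I_(n + 1)) :
  \sum_(i < m) (invmx G *m A^T) k i ^+ 2 <= (c * m%:R)^-1.
Proof.
have GT : G^T = G by rewrite /G trmx_mul trmxK.
have -> : \sum_(i < m) (invmx G *m A^T) k i ^+ 2 = invmx G k k.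
  have CC : (invmx G *m A^T) *m (invmx G *m A^T)^T = invmx G.
    by rewrite trmx_mul trmxK trmx_inv GT mulmxA -(mulmxA (invmx G)) mulVmx ?mul1mx// BEL_gram_unit.
  by rewrite -[in RHS]CC [RHS]mxE; apply: eq_bigr => i _; rewrite [X in _ * X]mxE.
pose v := col k (invmx G).
have := form_ge v.
have Gv : G *m v = delta_mx k 0 by rewrite /v colE mulmxA mulmxV ?mul1mx// BEL_gram_unit.
rewrite formE Gv -colE [leRHS]mxE [leRHS]mxE.
have vk : v k 0 = invmx G k k by rewrite mxE.
rewrite vk => h.
have vv : (invmx G k k) ^+ 2 <= `|v| ^+ 2.
  rewrite -vk -[leLHS]ger0_norm ?sqr_ge0// normrX lerXn2r ?nnegrE//.
  exact: coord_le_norm.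
rewrite -[leRHS]mul1r ler_pdivlMr//.
have : 0 <= invmx G k k.
  by apply: le_trans h; rewrite mulr_ge0 ?sqr_ge0// ltW.
rewrite le_eqVlt => /predU1P[<-|Gk]; first by rewrite mul0r.
rewrite -(ler_pM2l Gk) mulr1; apply: le_trans h.
by rewrite mulrA -expr2 mulrC ler_pM2l.
Qed.

End least_squares.

(** The polarization identity for [a i] and [xo] makes the noiseless squared range, less
    [|a i| ^+ 2], linear in [xo] and [|xo| ^+ 2]. *)
Lemma BEL_bE (R : realType) (n : nat) (a : nat -> 'cV[R]_n) (xo : 'cV[R]_n) (s : R)
    (x : nat -> R) m :
  BEL_b a s (fun i => enorm (a i - xo) + x i) m =
  BEL_A a m *m col_mx xo (const_mx (enorm xo ^+ 2)) +
  \col_(i < m) (2 * enorm (a i - xo) * x i + x i ^+ 2 - s ^+ 2).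
Proof.
apply/colP => i; rewrite mxE [RHS]mxE BEL_A_mul sensor_formE col_mxKu col_mxKd !mxE.
have -> : \sum_j xo^T 0 j * a i j 0 =
    (enorm (a i) ^+ 2 + enorm xo ^+ 2 - enorm (a i - xo) ^+ 2) / 2.
  rewrite !enorm_sqr -big_split -sumrB mulr_suml; apply: eq_bigr => j _.
  by rewrite !mxE /=; field.
by field.
Qed.

Theorem theorem4 (R : realType) (n : nat) (hn : n = 2%N \/ n = 3%N)
    (d : measure_display) (T : measurableType d) (P : probability T R)
    (a : nat -> 'cV[R]_n) (xo : 'cV[R]_n)
    (sigma : R) (r : nat -> {RV P >-> R})
    (X SA : set 'cV[R]_n) (mu : probability (borelType R n) R)
    (yhat : nat -> T -> 'cV[R]_(n + 1))
    (sigma_ge0 : 0 <= sigma)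
    (A1 : iid_centered_gaussian sigma r)
    (A2_compact : compact X)
    (A2_interior : X^° xo)
    (A2_bounded : bounded_set SA)
    (A2_sensors : forall i, SA (a i))
    (A2_outside : forall i, ~ X (a i))
    (A3 : forall z : 'cV[R]_n,
      {for z, continuous (distribution_function mu)} ->
      sample_df a m z @[m --> \oo] --> distribution_function mu z)
    (A6 : forall S : set 'cV[R]_n,
      (n = 2%N /\ affine_flat 1 S) \/ (n = 3%N /\ affine_flat 2 S) ->
      mu S <> 1%E)
    (hyhat : is_BEL a sigma xo r yhat) :
  bigO_p P (fun m w => usubmx (yhat m w) - xo)
    (fun m => (Num.sqrt m%:R)^-1).
Proof.
have [K aK] : exists K, forall i, `|a i| <= K.
  have [K [_ HK]] := A2_bounded; exists (K + 1) => i.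
  by apply: (HK (K + 1)); [rewrite ltrDl|exact: A2_sensors].
have not_flat S : affine_flat n.-1 S -> mu S <> 1%E.
  move=> flatS; apply: A6; case: hn => n_eq; [left|right]; split => //.
    by move: flatS; have -> : n.-1 = 1%N by rewrite n_eq.
  by move: flatS; have -> : n.-1 = 2%N by rewrite n_eq.
have [c [M [c0 form_ge]]] := sensor_form_uniform A3 aK not_flat.
pose e i := enorm (a i - xo).
have eK i : `|e i| <= Num.sqrt ((K + `|xo|) ^+ 2 *+ n).
  rewrite ger0_norm ?sqrtr_ge0//; apply: enorm_le.
  by rewrite (le_trans (ler_normB _ _))// lerD2r.
have [V [V0 intY orthY varY]] := noise_orthogonal sigma_ge0 A1 eK.
pose Y i w := 2 * e i * r i w + r i w ^+ 2 - sigma ^+ 2.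
have mY i : measurable_fun setT (Y i).
  apply: measurable_funB => //; apply: measurable_funD; first exact: measurable_funM.
  exact: measurable_funX.
move=> eps eps0.
(* Markov will bound the probability by [(n * V / c) / N ^+ 2]. The summand 1 gives
   [N * eps > n * V / c] and [N >= 1], hence [N ^+ 2 * eps > n * V / c]. *)
pose N := n%:R * V / c / eps + 1.
have N1 : 1 <= N by rewrite lerDr !divr_ge0// ?mulr_ge0// ltW.
exists M, N => m Mm.
have m0 : (0 < m)%N by exact: leq_ltn_trans Mm.
have fm := form_ge m (ltnW Mm).
pose A := BEL_A a m.
pose C := invmx (A^T *m A) *m A^T.
pose u (k : 'I_n) w := \sum_(i < m) C (lshift 1 k) i * Y i w.
(* Beyond [M] the Gram matrix is invertible, so the estimator is prescribed at every [w]. Rewriting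
   its error through [u] also supplies the measurability that [yhat] is not assumed to have. *)
have yhatE w : usubmx (yhat m w) - xo = \col_k u k w.
  have GU : A^T *m A \in unitmx by exact: (BEL_gram_unit c0 m0 fm).
  rewrite (hyhat _ _ GU) BEL_bE -/A mulmxDr mulmxA -(mulmxA _ A^T) mulVmx// mul1mx.
  rewrite linearD/= col_mxKu addrC addKr.
  apply/colP => k; rewrite !mxE; apply: eq_bigr => i _; rewrite [X in _ * X]mxE.
  by [].
pose S w := \sum_k m%:R * u k w ^+ 2.
have S0 w : 0 <= S w by apply: sumr_ge0 => k _; rewrite mulr_ge0// sqr_ge0.
have measurable_u k : measurable_fun setT (u k).
  by apply: measurable_sum => i; exact: measurable_funM.
have mS : measurable_fun setT S.
  by apply: measurable_sum => k; apply: measurable_funM => //; exact: measurable_funX.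
have normE w : enorm ((Num.sqrt m%:R)^-1^-1 *: (usubmx (yhat m w) - xo)) ^+ 2 = S w.
  rewrite enorm_sqr invrK yhatE; apply: eq_bigr => k _.
  by rewrite !mxE exprMn sqr_sqrtr.
have N0 : 0 < N by exact: lt_le_trans N1.
have -> : [set w | N < enorm ((Num.sqrt m%:R)^-1^-1 *: (usubmx (yhat m w) - xo))] =
    [set w | N ^+ 2 < S w].
  apply/seteqP; split => w /=;
    by rewrite -normE ltr_pXn2r ?nnegrE ?sqrtr_ge0 ?(ltW N0).
have ES : (\int[P]_w (S w)%:E <= (n%:R * V / c)%:E)%E.
  under eq_integral do rewrite /S -sumEFin.
  rewrite ge0_integral_sum//; last 2 first.
  - by move=> k; apply/measurable_EFinP/measurable_funM => //; exact: measurable_funX.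
  - by move=> k w _; rewrite lee_fin mulr_ge0// sqr_ge0.
  apply: (@le_trans _ _ (\sum_(k < n) (V / c)%:E)%E); last first.
    by rewrite sumEFin sumr_const card_ord -mulrA mulr_natl.
  apply: lee_sum => k _; under eq_integral do rewrite EFinM.
  rewrite ge0_integralZl//; last 2 first.
  - by apply/measurable_EFinP; exact: measurable_funX.
  - by move=> w _; rewrite lee_fin sqr_ge0.
  have := orthogonal_sum_sqr (fun i => C (lshift 1 k) i) intY orthY varY.
  move=> /(lee_wpmul2l (_ : (0 <= m%:R%:E)%E)); rewrite lee_fin => /(_ (ler0n _ _)).
  move=> /le_trans; apply; rewrite -EFinM lee_fin.
  (* The factor [m] from the scaling cancels the one in [(c * m)^-1], so each coordinate contributes
     at most [V / c]. *)
  have := BEL_pinv_row_sqr c0 m0 fm (lshift 1 k).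
  move=> /(ler_wpM2l V0)/(ler_wpM2l (ler0n R m)) /le_trans; apply.
  by rewrite le_eqVlt; apply/orP; left; apply/eqP; field; rewrite !gt_eqF// ltr0n.
apply: (le_lt_trans (ge0_markov mS S0 _ ES)).
  by rewrite exprn_gt0.
rewrite lte_fin ltr_pdivrMr ?exprn_gt0//.
have NE : N * eps = n%:R * V / c + eps by rewrite /N mulrDl mul1r divfK ?gt_eqF.
apply: (@lt_le_trans _ _ (N * eps)); first by rewrite NE ltrDl.
by rewrite mulrC ler_pM2l// expr2 ler_peMl// ltW.
Qed.
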